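(* Let $a\ge 2$ and $b\geq 1$ be integers. Then $$\operatorname{F}\left(\frac{\langle a,a+1\rangle}{b}\right)=\max_{i=1,\dots,a-1}\left(\left\lceil\frac{(bi\bmod a)(a+1)-b\,i}{a\,b}\right\rceil a+i\right)-a$$ and $$\operatorname{g}\left(\frac{\langle a,a+1\rangle}{b}\right)=\frac1a\sum_{i=1}^{a-1}\left(\left\lceil\frac{(bi\bmod a)(a+1)-b\,i}{a\,b}\right\rceil a+i\right)-\frac{a-1}{2}=\sum_{i=1}^{a-1}\left\lceil\frac{(bi\bmod a)(a+1)-b\,i}{a\,b}\right\rceil .$$
   Context: $\mathbb{N}$ is the set of non-negative integers. A numerical semigroup is a subset $S\subseteq\mathbb{N}$ containing $0$, closed under addition, with $\mathbb{N}\setminus S$ finite. $\langle a,a+1\rangle=\{ua+v(a+1)\mid u,v\in\mathbb{N}\}$, which is a numerical semigroup. For a positive integer $d$, the quotient of a numerical semigroup $S$ by $d$ is the numerical semigroup $\frac{S}{d}=\{x\in\mathbb{N}\mid dx\in S\}$. The Frobenius number $\operatorname{F}(S)$ is the greatest integer not belonging to $S$ (so $\operatorname{F}(\mathbb{N})=-1$), and the genus $\operatorname{g}(S)$ is the cardinality of $\mathbb{N}\setminus S$. $(u\bmod a)$ denotes the remainder of the Euclidean division of $u$ by $a$, and $\lceil r\rceil$ is the least integer greater than or equal to the rational number $r$. *)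

(* Defs.v *)
From HB Require Import structures.
From mathcomp Require Import all_boot all_order all_algebra.
From mathcomp Require Import finmap boolp classical_sets functions cardinality.
From mathcomp Require Import zify.

Set Implicit Arguments.
Unset Strict Implicit.
Unset Printing Implicit Defensive.

Import Order.TTheory GRing.Theory Num.Theory.

Local Open Scope classical_set_scope.
Local Open Scope ring_scope.

Record numerical_semigroup := NumericalSemigroup {
  nsg_set :> set nat;
  nsg0 : nsg_set 0%N;
  nsgD : forall x y : nat, nsg_set x -> nsg_set y -> nsg_set (x + y)%N;
  nsg_cofinite : finite_set (~` nsg_set)
}.

Lemma cofinite_natP (A : set nat) :
  finite_set (~` A) <-> exists N : nat, forall n : nat, (N <= n)%N -> A n.
Proof.
split=> [/finite_seqP [s sE]|[N NA]].
  exists (\max_(i <- s) i).+1 => n nN; apply: contrapT => nA.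
  have /= ns : [set` s] n by rewrite -sE.
  have := @leq_bigmax_seq _ s xpredT (fun i => i) n ns isT.
  by rewrite leqNgt nN.
apply: (@sub_finite_set _ _ `I_N) (finite_II N) => n /= nA.
by rewrite ltnNge; apply/negP => /NA.
Qed.

Definition consec_set (a : nat) : set nat :=
  [set n | exists u v : nat, n = (u * a + v * (a + 1))%N].

Lemma consec_set0 a : consec_set a 0%N.
Proof. by exists 0%N, 0%N. Qed.

Lemma consec_setD a (x y : nat) :
  consec_set a x -> consec_set a y -> consec_set a (x + y)%N.
Proof.
move=> [u [v ->]] [u' [v' ->]]; exists (u + u')%N, (v + v')%N.
by rewrite !mulnDl addnACA.
Qed.

Lemma consec_set_cofinite a : finite_set (~` consec_set a).
Proof.
apply/cofinite_natP; exists (a * a)%N => n aan.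
have [a0|a_gt0] := posnP a; first by exists 0%N, n; rewrite a0; lia.
have qa : (a <= n %/ a)%N by rewrite leq_divRL.
have ra := ltn_pmod n a_gt0.
exists (n %/ a - n %% a)%N, (n %% a)%N.
have rq : (n %% a <= n %/ a)%N by lia.
by rewrite mulnDr muln1 addnA -mulnDl subnK// -divn_eq.
Qed.

(* <a, a+1> *)
Definition consec (a : nat) : numerical_semigroup :=
  NumericalSemigroup (@consec_set0 a) (@consec_setD a) (@consec_set_cofinite a).

Section Quotient.
Variables (S : numerical_semigroup) (d : nat).

Definition quot_set : set nat := [set x | nsg_set S (d * x)%N].

Lemma quot_set0 : quot_set 0%N.
Proof. by rewrite /quot_set /= muln0; exact: nsg0. Qed.

Lemma quot_setD (x y : nat) : quot_set x -> quot_set y -> quot_set (x + y)%N.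
Proof. by rewrite /quot_set /= mulnDr; exact: nsgD. Qed.

Lemma quot_set_cofinite : finite_set (~` quot_set).
Proof.
apply/cofinite_natP; have /cofinite_natP[N NS] := nsg_cofinite S.
have [d0|d_gt0] := posnP d.
  by exists 0%N => n _; rewrite /quot_set /= d0 mul0n; exact: nsg0.
exists N => n Nn; apply: NS; exact: leq_trans Nn (leq_pmull n d_gt0).
Qed.

(* S / d; only meaningful for d > 0, as d = 0 yields all of nat. *)
Definition nsg_quot : numerical_semigroup :=
  NumericalSemigroup quot_set0 quot_setD quot_set_cofinite.

End Quotient.

(* The greatest integer outside S ranges over int, so that it is -1 when S is
   all of nat. *)
Definition is_frobenius (S : numerical_semigroup) : set int :=
  [set f : int | (~` (Posz @` S)) f /\
                 forall z : int, (~` (Posz @` S)) z -> z <= f].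

Definition frobenius (S : numerical_semigroup) : int := xget 0 (is_frobenius S).

Lemma frobeniusP (S : numerical_semigroup) : is_frobenius S (frobenius S).
Proof.
apply: xgetPex.
have /cofinite_natP[N0 N0S] := nsg_cofinite S.
pose P (N : nat) := `[< forall n : nat, (N <= n)%N -> nsg_set S n >].
have exP : exists N, P N by exists N0; apply/asboolP.
case: (ex_minnP exP) => N /asboolP NS Nmin.
exists (N%:Z - 1); split=> /=.
  move=> [n Sn nE]; have NE : N = n.+1 by lia.
  suff /Nmin : P n by rewrite NE ltnn.
  apply/asboolP => m; rewrite leq_eqVlt => /predU1P[<-//|nm].
  by apply: NS; rewrite NE.
move=> z zS; rewrite leNgt; apply/negP => Nz; apply: zS.
by exists `|z|%N; [apply: NS; lia | lia].
Qed.

Lemma is_frobenius_unique (S : numerical_semigroup) (f : int) :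
  is_frobenius S f -> frobenius S = f.
Proof.
have [fS fmax] := frobeniusP S; move=> [gS gmax].
by apply: le_anti; rewrite gmax// fmax.
Qed.

Definition genus (S : numerical_semigroup) : nat := #|` fset_set (~` S)|%fset.

(* ceil (((b i mod a) (a + 1) - b i) / (a b)), the subtraction and the division
   being those of rat. *)
Definition kceil (a b i : nat) : int :=
  Num.ceil (((((b * i) %% a)%N)%:R * (a%:R + 1) - b%:R * i%:R)
            / (a%:R * b%:R) : rat).

(* Maximum of f 1, ..., f (a - 1), for a >= 2: starting from f 1 rather than
   from a default value makes this the maximum of exactly these values. *)
Definition max_from1 (a : nat) (f : nat -> int) : int :=
  \big[Num.max/f 1%N]_(1 <= i < a) f i.

(* Main.v *)
Require Import Defs.
From mathcomp Require Import all_boot all_order all_algebra.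
From mathcomp Require Import finmap classical_sets cardinality.
From mathcomp Require Import zify ring lra.

Import Order.TTheory GRing.Theory Num.Theory.

Local Open Scope ring_scope.

(** An integer n = q a + r with r < a lies in <a, a+1> iff r <= q, that is, iff
    (n mod a)(a + 1) <= n.  Applied to n = b (t a + i), this says that t a + i
    lies in <a, a+1>/b iff t >= kceil a b i.  Hence the elements
    kceil a b i * a + i, for i < a, form the Apery set of a in the quotient, and
    Selmer's formulas express F and g in terms of the Apery set. *)

Lemma consec_setE {a : nat} (n : nat) (a_gt0 : (0 < a)%N) :
  consec_set a n <-> ((n %% a) * (a + 1) <= n)%N.
Proof.
have nE := divn_eq n a; split=> [[u [v nuv]]|rn].
  have -> : (n %% a = v %% a)%N.
    by rewrite nuv mulnDr muln1 addnA -mulnDl modnMDl.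
  (* Since [v %% a <= v], already the summand [v * (a + 1)] of [n] is large enough. *)
  have := leq_mod v a; nia.
have rq : (n %% a <= n %/ a)%N by nia.
(* With [n = q a + r], write [n = (q - r) a + r (a + 1)]. *)
exists (n %/ a - n %% a)%N, (n %% a)%N.
by rewrite mulnDr muln1 addnA -mulnDl subnK.
Qed.

Lemma kceil_leE {a b : nat} (i t : nat) (a_gt0 : (0 < a)%N) (b_gt0 : (0 < b)%N) :
  (kceil a b i <= t%:Z) =
  (((b * i) %% a) * (a + 1) <= b * (t * a + i))%N.
Proof.
have ab_gt0 : 0 < (a%:R * b%:R : rat) by rewrite mulr_gt0 ?ltr0n.
rewrite /kceil -[RHS](ler_nat rat) ceil_le_int ler_pdivrMr//.
rewrite lerBlDr !(natrM, natrD); congr (_ <= _).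
by rewrite -pmulrn; ring.
Qed.

(** As [b i < a b], the fraction exceeds -1, and so does its ceiling. Hence taking absolute values
    to land in [nat] loses nothing. *)
Lemma kceil_ge0 {a b i : nat} (b_gt0 : (0 < b)%N) (ia : (i < a)%N) :
  0 <= kceil a b i.
Proof.
have a_gt0 : (0 < a)%N by apply: leq_trans ia.
have ab_gt0 : 0 < (a%:R * b%:R : rat) by rewrite mulr_gt0 ?ltr0n.
suff : -1 < kceil a b i by lia.
rewrite /kceil ceil_gt_int ltr_pdivlMr//.
have : (b * i < a * b)%N by rewrite mulnC ltn_pmul2r.
rewrite -(ltr_nat rat) !natrM => bi.
have : 0 <= ((b * i) %% a)%N%:R * (a%:R + 1) :> rat.
  by rewrite mulr_ge0 ?addr_ge0 ?ler0n.
rewrite mulrN1z; lra.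
Qed.

Lemma quot_consecE {a b : nat} (t i : nat) (b_gt0 : (0 < b)%N) (ia : (i < a)%N) :
  nsg_set (nsg_quot (consec a) b) (t * a + i)%N <-> (`|kceil a b i|%N <= t)%N.
Proof.
have a_gt0 : (0 < a)%N by apply: leq_trans ia.
have -> : (`|kceil a b i|%N <= t)%N = (kceil a b i <= t%:Z).
  by have := kceil_ge0 b_gt0 ia; lia.
rewrite kceil_leE// /= /quot_set /=.
apply: (iff_trans (consec_setE _ a_gt0)).
by rewrite (mulnDr b) mulnA modnMDl.
Qed.

Section Apery.
Context {S : numerical_semigroup} {a : nat} {k : nat -> nat}.
Hypothesis a_gt1 : (1 < a)%N.
(** The [k i] are the Kunz coordinates of [S]: [k i * a + i] is the least element of [S] congruent
    to [i] modulo [a]. *)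
Hypothesis aperyP : forall t i : nat, (i < a)%N ->
  nsg_set S (t * a + i)%N <-> (k i <= t)%N.

Let a_gt0 : (0 < a)%N. Proof. exact: ltnW. Qed.

Lemma apery_gapE (x : nat) : ~ nsg_set S x <-> (x %/ a < k (x %% a))%N.
Proof.
by rewrite {1}(divn_eq x a) aperyP ?ltn_pmod// ltnNge; split=> /negP.
Qed.

Lemma apery0 : k 0 = 0%N.
Proof.
by have [+ _] := aperyP 0 0 a_gt0; rewrite mul0n leqn0 => /(_ (nsg0 S))/eqP.
Qed.

(** In the class of [i] modulo [a], the greatest integer outside [S] is [k i * a + i - a]. *)
Lemma frobenius_apery :
  frobenius S = max_from1 a (fun i => (k i)%:Z * a%:Z + i%:Z) - a%:Z.
Proof.
pose w i := (k i)%:Z * a%:Z + i%:Z.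
have le_max i : (1 <= i < a)%N -> w i <= max_from1 a w.
  by move=> i1a; apply: le_bigmax_seq; rewrite ?mem_index_iota.
have [i i1a i_max] : exists2 i, (1 <= i < a)%N & max_from1 a w = w i.
  rewrite /max_from1 big_seq; elim/big_ind: _ => [|x y [i ? ->] [j ? ->]|i].
  - by exists 1%N.
  - by case: (leP (w i) (w j)) => _; [exists j | exists i].
  - by rewrite mem_index_iota; exists i.
rewrite -/w i_max; apply: is_frobenius_unique; split=> /=.
  move=> [x Sx xE]; have /andP[i_gt0 ia] := i1a.
  have {}xE : x%:Z = (k i)%:Z * a%:Z + i%:Z - a%:Z by [].
  (* If [k i = 0], then [x = i - a] would be negative. *)
  have ki_gt0 : (0 < k i)%N by nia.
  have {}xE : x = ((k i).-1 * a + i)%N by nia.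
  by move: Sx; rewrite xE (aperyP _ _ ia); lia.
(* Negative integers are at most -1, and [w (a - 1) - a >= -1]. *)
case=> [x xS|n _]; last first.
  have : (1 <= a.-1 < a)%N by lia.
  by move=> /le_max; rewrite i_max /w NegzE; nia.
have /apery_gapE xk : ~ nsg_set S x by move=> Sx; apply: xS; exists x.
have xa := ltn_pmod x a_gt0.
(* The class of 0 has no gap in [nat], so the maximum may start at index 1. *)
have x0 : (0 < x %% a)%N.
  by rewrite lt0n; apply/eqP => xa0; move: xk; rewrite xa0 apery0.
have /le_max : (1 <= x %% a < a)%N by rewrite x0.
have := divn_eq x a; rewrite i_max /w; nia.
Qed.

(** The gaps in the class of [i] are the [t * a + i] with [t < k i]; Euclidean division makes this
    listing free of repetitions. *)
Lemma genus_apery : genus S = (\sum_(1 <= i < a) k i)%N.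
Proof.
pose gaps := [seq (t * a + i)%N | i <- iota 0 a, t <- iota 0 (k i)].
have gapsE : (~` nsg_set S = [set` [fset x in gaps]%fset])%classic.
  apply/seteqP; split=> x /=; rewrite in_fset /=.
    move=> /apery_gapE xk; apply/allpairsPdep; exists (x %% a)%N, (x %/ a)%N.
    by rewrite !mem_iota !add0n ltn_pmod//; split=> //; exact: divn_eq.
  move=> /allpairsPdep[i [t []]]; rewrite !mem_iota !add0n /= => ia tk ->.
  by rewrite (aperyP _ _ ia) leqNgt tk.
rewrite /genus gapsE set_fsetK card_fseq undup_id; last first.
  apply: allpairs_uniq_dep => [|i _|]; rewrite ?iota_uniq//.
  move=> _ _ /allpairsPdep[i [t [+ _ ->]]] /allpairsPdep[j [u [+ _ ->]]] /=.
  rewrite !mem_iota !add0n => /= ia ja E.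
  have ij : i = j.
    by have := congr1 (modn^~ a) E; rewrite /= !modnMDl !modn_small.
  by move: E; rewrite ij => /addIn/eqP; rewrite eqn_pmul2r// => /eqP->.
rewrite size_allpairs_dep sumnE big_map -[X in iota 0 X]subn0 -/(index_iota 0 a).
rewrite (eq_bigr k) => [|i _]; last by rewrite size_iota.
by rewrite big_ltn// apery0 add0n.
Qed.

End Apery.

Theorem mainTheorem3 (a b : nat) (ha : (2 <= a)%N) (hb : (1 <= b)%N) :
  frobenius (nsg_quot (consec a) b)
    = max_from1 a (fun i => kceil a b i * a%:Z + i%:Z) - a%:Z
  /\
  ((genus (nsg_quot (consec a) b))%:R
     = a%:R^-1 * (\sum_(1 <= i < a) (kceil a b i * a%:Z + i%:Z))%:~R
       - (a%:R - 1) / 2 :> rat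
   /\
   a%:R^-1 * (\sum_(1 <= i < a) (kceil a b i * a%:Z + i%:Z))%:~R
     - (a%:R - 1) / 2
     = (\sum_(1 <= i < a) kceil a b i)%:~R :> rat).
Proof.
have aperyP t i (ia : (i < a)%N) := quot_consecE t i hb ia.
have kE i : (1 <= i < a)%N -> (`|kceil a b i|%N)%:Z = kceil a b i.
  by move=> /andP[_ ia]; rewrite gez0_abs// kceil_ge0.
have genusE : (genus (nsg_quot (consec a) b))%:R
    = (\sum_(1 <= i < a) kceil a b i)%:~R :> rat.
  rewrite (genus_apery ha aperyP) -[LHS]/((_)%:Z%:~R) raddf_sum /=.
  by congr _%:~R; apply: eq_big_nat.
have sumE : a%:R^-1 * (\sum_(1 <= i < a) (kceil a b i * a%:Z + i%:Z))%:~R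
     - (a%:R - 1) / 2 = (\sum_(1 <= i < a) kceil a b i)%:~R :> rat.
  (* Divided by [a], the sum of the residues is exactly the correction [(a - 1) / 2]. *)
  have sum_id : (\sum_(1 <= i < a) i%:Z)%:~R = a%:R * (a%:R - 1) / 2 :> rat.
    elim: a ha {aperyP kE genusE} => [//|[//|[|n]] IHn _].
      by rewrite big_nat1; field.
    by rewrite big_nat_recr//= intrD IHn// -pmulrn -!natr1; field.
  have a_neq0 : a%:R != 0 :> rat by rewrite pnatr_eq0; lia.
  rewrite big_split /= -mulr_suml intrD intrM sum_id -pmulrn.
  by field.
split; last by rewrite genusE sumE.
rewrite (frobenius_apery ha aperyP); congr (_ - _); rewrite /max_from1.
(* The first rewrite treats the initial value of the maximum, at index 1 [< a]. *)
by rewrite kE//; apply: eq_big_nat => i /kE ->.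
Qed.
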